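(* Let $\{x^k\}_{k\ge0}$ be generated by the algorithm RZCW-PSS (described in the context). Assume that the iterates remain in $\mathcal L(x^0)=\{x\in\Omega:f(x)\le f(x^0)\}$, that $f$ is bounded below on $\mathcal L(x^0)$, and that the accepted objective values $f(x^k)$ are nonincreasing. Suppose that the support-identification safeguard in step S1g is used, with constants $\alpha>0$ and $\delta_{\rm supp}>0$: for each $k$, $x^{k+1}\in\widehat\Omega^k$ and $$f(x^{k+1})\le\min_{z\in\widehat\Omega^k}f(z)+\xi^k,$$ where $$\widehat\Omega^k=\Big\{y\in\Omega^k:\ \|y\|_0=s,\ \min_{i\in I_1(y)}|y_i|\ge\alpha,\ \text{and either } I_1(y)=I_1(x^k)\text{ or } f(x^k)-f(y)\ge\delta_{\rm supp}\Big\}.$$ Assume also that the starting point of the main loop satisfies $\|x^0\|_0=s$ and $\min_{i\in I_1(x^0)}|x^0_i|\ge\alpha$. Then there exist $K\ge 0$ and $T^\ast\subseteq[n]$ with $|T^\ast|=s$ such that $$I_1(x^k)=T^\ast,\qquad \min_{i\in T^\ast}|x^k_i|\ge\alpha,\qquad\forall k\ge K.$$ Consequently, every accumulation point $\bar x$ of the generated sequence satisfies $I_1(\bar x)=T^\ast$ and $\|\bar x\|_0=s$.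
   Context: Notation. $[n]=\{1,\dots,n\}$; $\|x\|_0$ is the number of nonzero components of $x$; $C_s=\{x\in\mathbb R^n:\|x\|_0\le s\}$; $I_1(x)=\{i:x_i\ne 0\}$, $I_0(x)=\{i:x_i=0\}$. $f:\mathbb R^n\to\mathbb R$ is continuously differentiable, $g=\nabla f$. $C\subseteq\mathbb R^n$ is closed, convex, and either nonnegative type-1 symmetric (all vectors of $C$ are componentwise nonnegative and $C$ is invariant under coordinate permutations) or type-2 symmetric (invariant under coordinate permutations and componentwise sign changes); $\Omega=C\cap C_s$. $\operatorname{proj}_S(x)$ denotes a Euclidean nearest point of $S$ to $x$. $\mathbf p(x)=x$ in the nonnegative type-1 case and $\mathbf p(x)=|x|$ (componentwise) in the type-2 case, with components $\mathbf p_i(x)$. A super support of $x\in\Omega$ is a set $\mathcal L\supseteq I_1(x)$ with $|\mathcal L|=s$. ZCW super supports. For $x\in\Omega$ let $Q(x)=\operatorname{argmin}_{q\in I_1(x)}\mathbf p_q(x)$. A ZCW super support at $x$ is any set $T=\big(S^\pi_{[\kappa,n]}\cup I_1(x)\cup\{j\}\big)\setminus\{q\}$ with $|T|=s$, where $q\in\operatorname{argmin}_{q'\in Q(x)}\mathbf p_{q'}(-g(x))$, $j\in\operatorname{argmin}_{j'\in I_0(x)}\{-\mathbf p_{j'}(-g(x))\}$, $\pi$ is a permutation of $[n]$ sorting $-\mathbf p(-g(x))$ in nonincreasing order, $\kappa\in[n]$, $S^\pi_{[\kappa,n]}=\{\pi(\kappa),\dots,\pi(n)\}$. The algorithm RZCW-PSS.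 It keeps iterates $x^k\in\Omega$ and a finite reservoir $\mathcal R\subset\Omega$. Initialization (S0): an initial point is projected onto $\Omega$; $\mathcal R$ is filled with projections onto $\Omega$ of finitely many perturbations of it by well-separated directions (pruned by objective value and mutual distance); the best of these points is improved by a basic feasible search (BFS), which repeatedly minimizes $f$ over sets $\{z\in C:I_1(z)\subseteq\mathcal L\}$ for super supports $\mathcal L$; the output is the starting iterate $x^0$ of the main loop. Iteration $k=0,1,2,\dots$: set $\Omega^k:=\{x^k\}$ and insert into $\Omega^k$ finitely many further points of $\Omega$, as follows. (S1a) If $\|x^k\|_0<s$: projections onto $\Omega$ of trial points from one-dimensional searches along coordinate directions. (S1b) If $\|x^k\|_0<s$: subspace candidates $\operatorname{proj}_\Omega(x^k+Ua^\ast)$, where the columns of $U$ are an orthonormal basis of the span of directions $d_\ell$, each obtained from $r^\ell-x^k$, $r^\ell\in\mathcal R$, by keeping only the components in $I_1(x^k)\cup\{j_\ell\}$ for some $j_\ell\in I_0(x^k)$, and $a^\ast$ is an approximate stationary point of $a\mapsto f(x^k+Ua)$ (or a point giving sufficient decrease). (S1c) If $\|x^k\|_0=s$: projected results of minimizing $t\mapsto f(x^k+te_i)$ for $i\in I_1(x^k)$, and swap candidates $x^k-x^k_qe_q+x^k_qe_j$ (and $x^k-x^k_qe_q-x^k_qe_j$ if $C$ is type-2 symmetric), with $q,j$ as in the definition of ZCW super supports at $x^k$. (S1d) If $\|x^k\|_0=s$: subspace candidates as in S1b. (S1e) If $\|x^k\|_0=s$: with probability $p^k\in(0,1)$, a randomly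 chosen ZCW super support $T^k$ at $x^k$ is generated, a point $r^k\in\Omega$ with $f(r^k)\le\min\{f(z):z\in C,\ I_1(z)\subseteq T^k\}+\varepsilon^k_T$, $\varepsilon_T^k\ge 0$, is computed, and $r^k$ is inserted into $\Omega^k$ and $\mathcal R$. (S1f) If no sufficient decrease has been generated: optional BFS-refined candidates and fresh well-separated sampled points of $\Omega$. (S1g) $x^{k+1}$ is selected from $\Omega^k$, or, with the safeguard, from $\widehat\Omega^k$ as in the claim, where $\xi^k\ge 0$ is the outer candidate-selection error; the current iterate is retained as a fallback, and a new point is accepted only if it decreases $f$. *)

(* Defs.v *)
From HB Require Import structures.
From mathcomp Require Export all_boot all_order all_algebra all_fingroup.
From mathcomp Require Export finmap.
From mathcomp Require Export all_classical all_reals all_analysis.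

Set Implicit Arguments.
Unset Strict Implicit.
Unset Printing Implicit Defensive.

Export Order.TTheory GRing.Theory Num.Theory.
Export numFieldNormedType.Exports.
Local Open Scope classical_set_scope.
Local Open Scope ring_scope.

(* The norm attached to 'rV[R]_n in the library is the sup norm, hence the
   separate Euclidean norm; topology and differentiability are the same for
   both norms. *)
Definition enorm (R : realType) (n : nat) (x : 'rV[R]_n) : R :=
  Num.sqrt (\sum_i x 0 i ^+ 2).

Definition grad (R : realType) (n : nat) (h : 'rV[R]_n -> R) (x : 'rV[R]_n) :
  'rV[R]_n := \row_i 'D_(delta_mx 0 i) h x.

Definition continuously_differentiable (R : realType) (n : nat)
    (f : 'rV[R]_n -> R) : Prop :=
  (forall x, differentiable f x) /\ continuous (grad f).

Definition supp (R : realType) (n : nat) (x : 'rV[R]_n) : {set 'I_n} :=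
  [set i | x 0 i != 0]%SET.

Definition zeros (R : realType) (n : nat) (x : 'rV[R]_n) : {set 'I_n} :=
  [set i | x 0 i == 0]%SET.

Definition norm0 (R : realType) (n : nat) (x : 'rV[R]_n) : nat := #|supp x|.

(* min_{i in A} |x_i|, with the convention min over the empty set = +oo. *)
Definition minabs (R : realType) (n : nat) (A : {set 'I_n}) (x : 'rV[R]_n) :
  \bar R := (\big[Order.min/+oo]_(i in A) `|x 0 i|%:E)%E.

Inductive symmetry := NonnegType1 | Type2.

Definition is_type2 (sym : symmetry) : bool :=
  if sym is Type2 then true else false.

Definition has_symmetry (R : realType) (n : nat) (sym : symmetry)
    (C : set 'rV[R]_n) : Prop :=
  (forall (sg : 'S_n) x, C x -> C (col_perm sg x)) /\
  match sym with
  | NonnegType1 => forall x, C x -> forall i, 0 <= x 0 i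
  | Type2 => forall (e : 'I_n -> bool) x,
      C x -> C (\row_i ((-1) ^+ e i * x 0 i))
  end.

Definition pabs (R : realType) (n : nat) (sym : symmetry) (x : 'rV[R]_n)
    (i : 'I_n) : R :=
  if is_type2 sym then `|x 0 i| else x 0 i.

Definition Omega (R : realType) (n : nat) (C : set 'rV[R]_n) (s : nat) :
  set 'rV[R]_n := [set x | C x /\ (norm0 x <= s)%N].

Definition is_proj (R : realType) (n : nat) (S : set 'rV[R]_n)
    (x y : 'rV[R]_n) : Prop :=
  S y /\ forall z, S z -> enorm (x - y) <= enorm (x - z).

Definition level_set (R : realType) (n : nat) (f : 'rV[R]_n -> R)
    (C : set 'rV[R]_n) (s : nat) (x0 : 'rV[R]_n) : set 'rV[R]_n :=
  [set x | Omega C s x /\ f x <= f x0].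

Definition argmin (R : realType) (n : nat) (A : {set 'I_n}) (phi : 'I_n -> R) :
  {set 'I_n} := [set i in A | [forall j in A, phi i <= phi j]]%SET.

Definition super_support (R : realType) (n : nat) (s : nat) (x : 'rV[R]_n)
    (L : {set 'I_n}) : Prop :=
  supp x \subset L /\ #|L| = s.

Definition restricted (R : realType) (n : nat) (C : set 'rV[R]_n)
    (L : {set 'I_n}) : set 'rV[R]_n :=
  [set z | C z /\ supp z \subset L].

Definition zcw_q (R : realType) (n : nat) (f : 'rV[R]_n -> R) (sym : symmetry)
    (x : 'rV[R]_n) : {set 'I_n} :=
  argmin (argmin (supp x) (pabs sym x)) (pabs sym (- grad f x)).

Definition zcw_j (R : realType) (n : nat) (f : 'rV[R]_n -> R) (sym : symmetry)
    (x : 'rV[R]_n) : {set 'I_n} :=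
  argmin (zeros x) (fun j => - pabs sym (- grad f x) j).

(* Positions are counted from 0, so kappa : 'I_n stands for kappa + 1. *)
Definition zcw_super_support (R : realType) (n : nat) (f : 'rV[R]_n -> R)
    (s : nat) (sym : symmetry) (x : 'rV[R]_n) (T : {set 'I_n}) : Prop :=
  exists (q j kappa : 'I_n) (pi : 'S_n),
    [/\ q \in zcw_q f sym x, j \in zcw_j f sym x,
        forall a b : 'I_n, (a <= b)%N ->
          - pabs sym (- grad f x) (pi b) <= - pabs sym (- grad f x) (pi a),
        T = (([set pi i | i : 'I_n & (kappa <= i)%N] :|: supp x :|: [set j])
              :\ q)%SET
      & #|T| = s].

Inductive bfs (R : realType) (n : nat) (f : 'rV[R]_n -> R) (C : set 'rV[R]_n)
    (s : nat) : 'rV[R]_n -> 'rV[R]_n -> Prop :=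
| bfs_stop u : bfs f C s u u
| bfs_step u L v w :
    super_support s u L ->
    restricted C L v -> (forall z, restricted C L z -> f v <= f z) ->
    bfs f C s v w -> bfs f C s u w.

Definition well_separated (R : realType) (n : nat) (sep : R)
    (A : {fset 'rV[R]_n}) : Prop :=
  forall u v, u \in A -> v \in A -> u != v -> sep <= enorm (u - v).

(* A0 is what pruning leaves of A: no member exceeds the value cut, distinct
   members are at distance at least sep, and a point of A is discarded only if
   its value exceeds cut or a point at least as good is kept closer than sep. *)
Definition pruned (R : realType) (n : nat) (f : 'rV[R]_n -> R) (cut sep : R)
    (A A0 : {fset 'rV[R]_n}) : Prop :=
  [/\ {subset A0 <= A}, forall u, u \in A0 -> f u <= cut,
      well_separated sep A0
    & forall u, u \in A -> u \notin A0 ->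
        cut < f u \/ exists v, [/\ v \in A0, f v <= f u & enorm (u - v) < sep]].

(* Quantities that the description of the algorithm leaves free:
   - sep_dir, sep_pt: minimal distances between directions, resp. points;
   - cut: objective value above which initial points are pruned;
   - dec k: amount counting as a sufficient decrease at iteration k;
   - tol k: stationarity tolerance in the subspace searches;
   - eps k: accuracy of the minimization over a random ZCW super support;
   - prob k: probability of drawing such a super support.  It does not enter the
     description of a run, which is one realization of the random choices: as
     it lies strictly between 0 and 1, both outcomes of the draw can occur at
     each iteration. *)
Record rzcw_params (R : realType) := RzcwParams {
  sep_dir : R;
  sep_pt : R;
  cut : R;
  dec : nat -> R;
  tol : nat -> R;
  eps : nat -> R;
  prob : nat -> R;
  sep_dir_gt0 : 0 < sep_dir;
  sep_pt_gt0 : 0 < sep_pt;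
  dec_gt0 : forall k, 0 < dec k;
  tol_ge0 : forall k, 0 <= tol k;
  eps_ge0 : forall k, 0 <= eps k;
  prob_itv : forall k, 0 < prob k < 1
}.

(* One iteration: the iterate x^k, the reservoir at its beginning, and the finite
   sets of points inserted into Omega^k.  When norm0 x^k < s these are the
   coordinate (st_coord) and subspace (st_sub) candidates; when norm0 x^k = s
   they are the line searches on the support (st_line), the swaps (st_swap), the
   subspace candidates (st_subs) and the random one: st_rand is Some (T, r) if
   the draw succeeds, with super support T and point r, and None otherwise.
   st_bfs and st_smp are inserted when no sufficient decrease was generated. *)
Record rzcw_state (R : realType) (n : nat) := RzcwState {
  st_x : 'rV[R]_n;
  st_res : {fset 'rV[R]_n};
  st_coord : {fset 'rV[R]_n};
  st_sub : {fset 'rV[R]_n};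
  st_line : {fset 'rV[R]_n};
  st_swap : {fset 'rV[R]_n};
  st_subs : {fset 'rV[R]_n};
  st_rand : option ({set 'I_n} * 'rV[R]_n);
  st_bfs : {fset 'rV[R]_n};
  st_smp : {fset 'rV[R]_n}
}.

Definition rand_points (R : realType) (n : nat) (st : rzcw_state R n) :
  {fset 'rV[R]_n} := if st_rand st is Some (_, r) then [fset r]%fset else fset0.

(* What Omega^k contains when sufficient decrease is tested; candidates is the
   whole of Omega^k. *)
Definition generated (R : realType) (n : nat) (st : rzcw_state R n) :
  {fset 'rV[R]_n} :=
  ([fset st_x st] `|` st_coord st `|` st_sub st `|` st_line st `|` st_swap st
     `|` st_subs st `|` rand_points st)%fset.

Definition candidates (R : realType) (n : nat) (st : rzcw_state R n) :
  {fset 'rV[R]_n} := (generated st `|` st_bfs st `|` st_smp st)%fset.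

Definition coord_candidate (R : realType) (n : nat) (C : set 'rV[R]_n)
    (s : nat) (x y : 'rV[R]_n) : Prop :=
  exists (i : 'I_n) (t : R), is_proj (Omega C s) (x + t *: delta_mx 0 i) y.

Definition keep_components (R : realType) (n : nat) (A : {set 'I_n})
    (v : 'rV[R]_n) : 'rV[R]_n := \row_i (if i \in A then v 0 i else 0).

(* The rows of U (not its columns, vectors being rows) are an orthonormal basis
   of the span of the directions d_l = row l of the displayed matrix. *)
Definition subspace_candidate (R : realType) (n : nat) (f : 'rV[R]_n -> R)
    (C : set 'rV[R]_n) (s : nat) (dec tol : R) (res : {fset 'rV[R]_n})
    (x y : 'rV[R]_n) : Prop :=
  exists (p : nat) (r : 'I_p -> 'rV[R]_n) (j : 'I_p -> 'I_n)
         (m : nat) (U : 'M[R]_(m, n)) (a : 'rV[R]_m),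
    [/\ forall l, r l \in res /\ j l \in zeros x,
        (U :=: \matrix_(l < p) keep_components (j l |: supp x) (r l - x))%MS,
        U *m U^T = 1%:M,
        enorm (grad (fun b : 'rV[R]_m => f (x + b *m U)) a) <= tol \/
          f (x + a *m U) <= f x - dec
      & is_proj (Omega C s) (x + a *m U) y].

Definition line_candidate (R : realType) (n : nat) (f : 'rV[R]_n -> R)
    (C : set 'rV[R]_n) (s : nat) (x y : 'rV[R]_n) : Prop :=
  exists (i : 'I_n) (t : R),
    [/\ i \in supp x,
        forall u, f (x + t *: delta_mx 0 i) <= f (x + u *: delta_mx 0 i)
      & is_proj (Omega C s) (x + t *: delta_mx 0 i) y].

Definition swap_candidate (R : realType) (n : nat) (f : 'rV[R]_n -> R)
    (sym : symmetry) (x y : 'rV[R]_n) : Prop :=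
  exists q j : 'I_n,
    [/\ q \in zcw_q f sym x, j \in zcw_j f sym x
      & y = x - x 0 q *: delta_mx 0 q + x 0 q *: delta_mx 0 j \/
        is_type2 sym /\
          y = x - x 0 q *: delta_mx 0 q - x 0 q *: delta_mx 0 j].

Definition rand_insertion (R : realType) (n : nat) (f : 'rV[R]_n -> R)
    (C : set 'rV[R]_n) (s : nat) (sym : symmetry) (eps : R) (x : 'rV[R]_n)
    (T : {set 'I_n}) (r : 'rV[R]_n) : Prop :=
  [/\ zcw_super_support f s sym x T, Omega C s r
    & ((f r)%:E <= ereal_inf [set (f z)%:E | z in restricted C T] + eps%:E)%E].

Definition rzcw_init (R : realType) (n : nat) (f : 'rV[R]_n -> R)
    (C : set 'rV[R]_n) (s : nat) (prm : rzcw_params R) (st : rzcw_state R n) :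
  Prop :=
  exists (z y : 'rV[R]_n) (D A : {fset 'rV[R]_n}) (b : 'rV[R]_n),
    [/\ is_proj (Omega C s) z y, well_separated (sep_dir prm) D,
        forall u, u \in A -> exists2 d, d \in D &
          exists2 t : R, 0 < t & is_proj (Omega C s) (y + t *: d) u,
        pruned f (cut prm) (sep_pt prm) A (st_res st)
      & [/\ b \in st_res st, forall u, u \in st_res st -> f b <= f u
          & bfs f C s b (st_x st)]].

Definition rzcw_insertions (R : realType) (n : nat) (f : 'rV[R]_n -> R)
    (C : set 'rV[R]_n) (s : nat) (sym : symmetry) (prm : rzcw_params R)
    (k : nat) (st : rzcw_state R n) : Prop :=
  let x := st_x st in
  let sub_cand := subspace_candidate f C s (dec prm k) (tol prm k) (st_res st) in
  let no_decrease := forall y, y \in generated st -> f x - dec prm k < f y in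
  (forall y, y \in candidates st -> Omega C s y) /\
  [/\ forall y, y \in st_coord st -> (norm0 x < s)%N /\ coord_candidate C s x y,
      forall y, y \in st_sub st -> (norm0 x < s)%N /\ sub_cand x y,
      forall y, y \in st_line st -> norm0 x = s /\ line_candidate f C s x y,
      forall y, y \in st_swap st -> norm0 x = s /\ swap_candidate f sym x y
    & forall y, y \in st_subs st -> norm0 x = s /\ sub_cand x y] /\
  [/\ forall T r, st_rand st = Some (T, r) ->
        norm0 x = s /\ rand_insertion f C s sym (eps prm k) x T r,
      forall y, y \in st_bfs st ->
        no_decrease /\ exists2 u, u \in generated st & bfs f C s u y,
      forall y, y \in st_smp st ->
        no_decrease /\
        forall u, u \in st_res st -> sep_pt prm <= enorm (y - u)
    & well_separated (sep_pt prm) (st_smp st)].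

Definition rzcw_update (R : realType) (n : nat) (f : 'rV[R]_n -> R)
    (st st' : rzcw_state R n) : Prop :=
  [/\ st_x st' \in candidates st,
      st_x st' = st_x st \/ f (st_x st') < f (st_x st)
    & st_res st' = (rand_points st `|` st_res st)%fset].

Definition rzcw_pss (R : realType) (n : nat) (f : 'rV[R]_n -> R)
    (C : set 'rV[R]_n) (s : nat) (sym : symmetry) (prm : rzcw_params R)
    (run : nat -> rzcw_state R n) : Prop :=
  rzcw_init f C s prm (run 0%N) /\
  forall k, rzcw_insertions f C s sym prm k (run k) /\
            rzcw_update f (run k) (run k.+1).

Definition safe_candidates (R : realType) (n : nat) (f : 'rV[R]_n -> R)
    (s : nat) (alpha delta : R) (st : rzcw_state R n) : {fset 'rV[R]_n} :=
  [fset y in candidates st |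
     [&& norm0 y == s, (alpha%:E <= minabs (supp y) y)%E
       & (supp y == supp (st_x st)) || (delta <= f (st_x st) - f y)]]%fset.

(* Safeguarded selection; the minimum over the finite set of safe candidates is
   taken in the extended reals, with value +oo on the empty set. *)
Definition safeguarded (R : realType) (n : nat) (f : 'rV[R]_n -> R)
    (s : nat) (alpha delta xi : R) (st st' : rzcw_state R n) : Prop :=
  let S := safe_candidates f s alpha delta st in
  st_x st' \in S /\
  ((f (st_x st'))%:E
     <= \big[Order.min/+oo]_(z <- enum_fset S) (f z)%:E + xi%:E)%E.

(* Main.v *)
(* By the safeguard, every change of support costs a decrease of f of at least
   delta_supp > 0.  The values f(x^k) are nonincreasing and bounded below, hence
   convergent, so only finitely many such decreases occur and the support is
   eventually a constant T*.  From then on each coordinate is either of modulus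
   at least alpha > 0 or zero, and this dichotomy passes to accumulation points
   coordinate by coordinate. *)
Require Import Defs.
Local Open Scope classical_set_scope.
Local Open Scope ring_scope.

(** The sequence converges to its limit from above: once [u k] lies below [limn u + delta], the next
    term, still at least [limn u], cannot be [delta] lower. *)
Lemma nonincreasing_small_drops (R : realType) (u : R ^nat) (delta : R) :
  (forall k, u k.+1 <= u k) -> has_lbound (range u) -> 0 < delta ->
  exists K, forall k, (K <= k)%N -> u k - u k.+1 < delta.
Proof.
move=> u_dec u_lb delta0.
have u_mono : {homo u : n m / (n <= m)%N >-> m <= n}.
  exact/nonincreasing_seqP.
have u_cvg := nonincreasing_is_cvgn u_mono u_lb.
have lim_lt : limn u < limn u + delta by rewrite ltrDl.
have [K _ HK] := cvgr_lt (limn u) u_cvg _ lim_lt.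
exists K => k /HK /= u_lt.
by rewrite ltrBlDl (lt_le_trans u_lt) // lerD2r nonincreasing_cvgn_ge.
Qed.

Lemma minabs_ge (R : realType) (n : nat) (A : {set 'I_n}) (x : 'rV[R]_n)
    (alpha : R) (i : 'I_n) :
  (alpha%:E <= minabs A x)%E -> i \in A -> alpha <= `|x 0 i|.
Proof.
move=> h iA; rewrite -lee_fin; apply: le_trans h _.
exact: bigmin_le_cond.
Qed.

(** Every tail of the sequence meets every neighbourhood of [xbar], in particular the slab cut out
    by the continuous [i]-th coordinate. *)
Lemma cluster_coord (R : realType) (n : nat) (x : nat -> 'rV[R]_n)
    (xbar : 'rV[R]_n) (i : 'I_n) (K : nat) (e : R) :
  cluster (x @ \oo) xbar -> 0 < e ->
  exists2 k, (K <= k)%N & `|xbar 0 i - x k 0 i| < e.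
Proof.
move=> x_cl e0.
have near_x : (x @ \oo) (x @` [set k | (K <= k)%N]).
  by exists K => // k /= leKk; exists k.
have near_xbar : nbhs xbar [set y : 'rV[R]_n | `|xbar 0 i - y 0 i| < e].
  have /cvgrPdist_lt : (fun y : 'rV[R]_n => y 0 i) @ xbar --> xbar 0 i.
    exact: coord_continuous.
  exact.
have [_ [[k leKk <-] xk_lt]] := x_cl _ _ near_x near_xbar.
by exists k.
Qed.

Lemma cluster_supp (R : realType) (n : nat) (x : nat -> 'rV[R]_n)
    (xbar : 'rV[R]_n) (T : {set 'I_n}) (K : nat) (alpha : R) :
  0 < alpha ->
  (forall k, (K <= k)%N -> supp (x k) = T /\ (alpha%:E <= minabs T (x k))%E) ->
  cluster (x @ \oo) xbar -> supp xbar = T.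
Proof.
move=> alpha0 x_supp x_cl; apply/setP => i; rewrite inE.
have [iT|iNT] := boolP (i \in T).
  (* With radius [alpha], a zero coordinate of [xbar] would force that of [x k] below [alpha] in
     modulus. *)
  have [k /x_supp [_ /minabs_ge /(_ iT) xk_ge]] := cluster_coord _ _ _ _ i K _ x_cl alpha0.
  apply: contraTneq => ->.
  by rewrite sub0r normrN -leNgt.
apply/negbTE/negPn/eqP; apply: contraNeq iNT => xbar_neq0.
have xbar0 : 0 < `|xbar 0 i| by rewrite normr_gt0.
(* The radius is [xbar]'s own coordinate in modulus, so that of [x k] cannot vanish. *)
have [k /x_supp [<- _]] := cluster_coord _ _ _ _ i K _ x_cl xbar0.
by rewrite inE; apply: contraTneq => ->; rewrite subr0 ltxx.
Qed.

Theorem lemma6 (R : realType) (n s : nat) (f : 'rV[R]_n -> R)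
    (C : set 'rV[R]_n) (sym : symmetry) (prm : rzcw_params R)
    (run : nat -> rzcw_state R n) (x : nat -> 'rV[R]_n)
    (alpha delta_supp : R) (xi : nat -> R)
    (hf : continuously_differentiable f)
    (hCclosed : closed C) (hCconvex : convex_set C) (hCsym : has_symmetry sym C)
    (hrun : rzcw_pss f C s sym prm run)
    (hx : forall k, x k = st_x (run k))
    (hlevel : forall k, level_set f C s (x 0%N) (x k))
    (hbounded : has_lbound [set f z | z in level_set f C s (x 0%N)])
    (hmono : forall k, f (x k.+1) <= f (x k))
    (halpha : 0 < alpha) (hdelta : 0 < delta_supp) (hxi : forall k, 0 <= xi k)
    (hsafe : forall k,
       safeguarded f s alpha delta_supp (xi k) (run k) (run k.+1))
    (hx0_card : norm0 (x 0%N) = s)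
    (hx0_min : (alpha%:E <= minabs (supp (x 0%N)) (x 0%N))%E) :
  exists (K : nat) (T : {set 'I_n}),
    [/\ #|T| = s,
        forall k, (K <= k)%N ->
          supp (x k) = T /\ (alpha%:E <= minabs T (x k))%E
      & forall xbar : 'rV[R]_n, cluster (x @ \oo) xbar ->
          supp xbar = T /\ norm0 xbar = s].
Proof.
have [K0 f_drop] : exists K, forall k, (K <= k)%N ->
    f (x k) - f (x k.+1) < delta_supp.
  apply: nonincreasing_small_drops => //.
  have [m m_lb] := hbounded; exists m => _ [k _ <-].
  by apply: m_lb; exists (x k).
have x_safe k : [/\ norm0 (x k.+1) = s,
    (alpha%:E <= minabs (supp (x k.+1)) (x k.+1))%E
    & supp (x k.+1) = supp (x k) \/ delta_supp <= f (x k) - f (x k.+1)].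
  have [+ _] := hsafe k; rewrite !inE /= -!hx.
  by case/andP => _ /and3P[/eqP ? ? /orP[/eqP ?|?]]; split=> //; [left|right].
have x_good k : norm0 (x k) = s /\ (alpha%:E <= minabs (supp (x k)) (x k))%E.
  (* The safeguard constrains successors only; index 0 rests on the assumptions on the starting
     point. *)
  by case: k => [//|k]; have [] := x_safe k.
have x_supp k : (K0 <= k)%N -> supp (x k) = supp (x K0).
  elim: k => [|k IHk]; first by rewrite leqn0 => /eqP ->.
  rewrite leq_eqVlt => /predU1P[<- //|]; rewrite ltnS => le0k.
  have [_ _ [-> |]] := x_safe k; first exact: IHk.
  (* A change of support would need a drop of at least [delta_supp], excluded from [K0] on. *)
  by rewrite leNgt f_drop.
have x_stable k : (K0 <= k)%N -> supp (x k) = supp (x K0) /\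
    (alpha%:E <= minabs (supp (x K0)) (x k))%E.
  by move=> /x_supp <-; split=> //; have [] := x_good k.
exists K0, (supp (x K0)); split=> //; first by have [] := x_good K0.
move=> xbar /(cluster_supp _ _ _ _ _ _ _ halpha x_stable) xbar_supp; split=> //.
by rewrite /norm0 xbar_supp; have [] := x_good K0.
Qed.
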